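(* Let $m\ge 0$ and $n\ge 1$ be integers and let $Q(x)=\sum_{j=0}^{2m}Q_jx^j$ be a real $n\times n$ regular symmetric positive semidefinite matrix polynomial of degree $2m$. Then all roots of the scalar polynomial $\det(Q(x))$ have even multiplicity if and only if there exists a real $n\times n$ matrix polynomial $G(x)=\sum_{j=0}^{m}G_jx^j$ of degree $m$ such that $$Q(x)=G(x)^TG(x).$$
   Context: An $n\times n$ matrix polynomial of degree $m$ is an expression $P(x)=\sum_{i=0}^m P_ix^i$ with $n\times n$ matrices $P_i$ (the definition does not require $P_m\neq 0$). It is called real if all $P_i$ are real matrices; symmetric if $P_i=P_i^T$ for all $i$; positive semidefinite if for every $x\in\mathbb{R}$ the matrix $P(x)$ is positive semidefinite; regular if $\det(P(x))$ is not identically zero. Here $G(x)^T=\sum_{j}G_j^Tx^j$. Roots of $\det(Q(x))$ are its roots in $\mathbb{C}$ (both real and non-real), with multiplicity as roots of a polynomial. *)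

(* Defs.v *)
From mathcomp Require Import all_boot all_order all_algebra.
From mathcomp Require Import complex reals.

Set Implicit Arguments.
Unset Strict Implicit.
Unset Printing Implicit Defensive.

Import GRing.Theory Num.Theory.
Local Open Scope ring_scope.

(* The matrix polynomial \sum_(j <= d) P_j x^j with coefficients P_0, ..., P_d,
   as a matrix over R[x]; the top coefficient P_d may vanish. *)
Definition mxpol (R : comNzRingType) (n d : nat) (P : 'I_d.+1 -> 'M[R]_n) :
    'M[{poly R}]_n :=
  \sum_(j < d.+1) 'X^j *: map_mx polyC (P j).

Definition mxpol_eval (R : comNzRingType) (n d : nat)
    (P : 'I_d.+1 -> 'M[R]_n) (x : R) : 'M[R]_n :=
  \sum_(j < d.+1) x ^+ j *: P j.

Lemma mxpol_evalE (R : comNzRingType) (n d : nat)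
    (P : 'I_d.+1 -> 'M[R]_n) (x : R) :
  map_mx (horner_eval x) (mxpol P) = mxpol_eval P x.
Proof.
apply/matrixP => i k; rewrite !mxE /horner_eval /mxpol !summxE horner_sum.
by apply: eq_bigr => j _; rewrite !mxE hornerM hornerXn hornerC.
Qed.

Definition mxpol_tr (R : comNzRingType) (n d : nat) (P : 'I_d.+1 -> 'M[R]_n) :
    'I_d.+1 -> 'M[R]_n :=
  fun j => (P j)^T.

Definition mxpol_symmetric (R : comNzRingType) (n d : nat)
    (P : 'I_d.+1 -> 'M[R]_n) : Prop :=
  forall j, P j = (P j)^T.

Definition psdmx (R : numDomainType) (n : nat) (A : 'M[R]_n) : Prop :=
  A^T = A /\ forall v : 'cV[R]_n, 0 <= (v^T *m A *m v) 0 0.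

Definition mxpol_psd (R : numDomainType) (n d : nat)
    (P : 'I_d.+1 -> 'M[R]_n) : Prop :=
  forall x : R, psdmx (mxpol_eval P x).

(* Over an infinite ring without zero divisors, a polynomial is zero iff it is
   identically zero as a function. *)
Definition mxpol_regular (R : comNzRingType) (n d : nat)
    (P : 'I_d.+1 -> 'M[R]_n) : Prop :=
  \det (mxpol P) != 0.

Definition all_complex_roots_even (R : realType) (p : {poly R}) : Prop :=
  let pC : {poly R[i]} := map_poly (real_complex R) p in
  forall z : R[i], root pC z -> ~~ odd (mup z pC).

(* Main.v *)
Require Import Defs.
From mathcomp Require Import all_boot all_order all_algebra.
From mathcomp Require Import perm complex reals polyrcf.
From mathcomp Require Import zify ring lra.

Set Implicit Arguments.
Unset Strict Implicit.
Unset Printing Implicit Defensive.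

Import Order.TTheory GRing.Theory Num.Theory.
Local Open Scope ring_scope.

(** A Gram factorization [Q = G^T G] makes [det Q] the square of [det G], so
    its roots have even multiplicity.  The converse removes the roots of
    [det Q] one at a time and then factors what is left.

    Removing a root.  Let [z] be a complex root of [det Q] and [p] its minimal
    polynomial over [R].  Suppose that a polynomial vector [u], nonzero at [z],
    satisfies [p | Q u] and [p^2 | u^T Q u].  After multiplying [u] by an
    inverse modulo [p] and adding a multiple of [p] one of its entries is 1, so
    [u] is a column of a unimodular matrix; in the new basis a row and a column
    of [Q] are divisible by [p], and their common entry by [p^2].  Dividing
    them out gives [Q = S^T Q' S] with [det S = p], and [Q'] is again
    positive semidefinite (lemma [residue_descent]).  Such a [u] exists:
    - if [z] is real, take a constant kernel vector of [Q(z)]: the nonnegative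
      polynomial [u^T Q u] vanishes at [z], hence to order two;
    - if [z] is not real, the value at [z] of [u^T Q u / p] is a quadratic form
      on the kernel of the complex symmetric matrix [Q(z)].  It has an isotropic
      vector as soon as the kernel is not a line.  If it did not vanish on some
      kernel vector and the kernel were a line, [p] would divide [det Q] exactly
      once; even multiplicity rules this out (lemma [closed_isotropic]).

    The unimodular case.  When [det Q] is a nonzero constant, let [2 d_i] bound
    the degree of [Q_ii].  Semidefiniteness gives [deg Q_ij <= d_i + d_j], and
    the coefficient of degree [2 (d_1 + ... + d_n)] of [det Q] is the
    determinant of the real matrix [L] of the coefficients of degree [d_i + d_j]
    of the [Q_ij].  If some [d_i] is positive, [L] is singular, and a kernel
    vector of [L] yields a unimodular change of basis that lowers the degree of
    one diagonal entry (lemma [psdpolmx_reduce]).  This ends with a constant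
    matrix, which has a Cholesky factorization.

    The degree bound on [G] holds because the diagonal of [G^T G] consists of
    sums of squares, whose leading terms cannot cancel. *)

(** * Bilinear forms and change of one basis vector *)

Definition bilin (R : comNzRingType) n (A : 'M[R]_n) (v w : 'cV[R]_n) : R :=
  (v^T *m A *m w) 0 0.

Lemma bilin_colE (R : comNzRingType) n (A : 'M[R]_n) v w :
  bilin A v w = \sum_i v i 0 * (A *m w) i 0.
Proof. by rewrite /bilin -mulmxA mxE; apply: eq_bigr => i _; rewrite mxE. Qed.

Lemma bilinC (R : comNzRingType) n (A : 'M[R]_n) v w :
  A^T = A -> bilin A v w = bilin A w v.
Proof.
move=> sA; transitivity ((v^T *m A *m w)^T 0 0); first by rewrite [RHS]mxE.
by rewrite !trmx_mul trmxK sA mulmxA.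
Qed.

Lemma bilinDr (R : comNzRingType) n (A : 'M[R]_n) v w w' :
  bilin A v (w + w') = bilin A v w + bilin A v w'.
Proof. by rewrite /bilin mulmxDr mxE. Qed.

Lemma bilinZr (R : comNzRingType) n (A : 'M[R]_n) v a w :
  bilin A v (a *: w) = a * bilin A v w.
Proof. by rewrite /bilin -scalemxAr mxE. Qed.

Lemma bilin_combination (R : comNzRingType) n (A : 'M[R]_n) a v b w :
    A^T = A ->
  bilin A (a *: v + b *: w) (a *: v + b *: w) =
    a ^+ 2 * bilin A v v + (a * b * bilin A v w) *+ 2 + b ^+ 2 * bilin A w w.
Proof.
move=> sA; rewrite bilinDr !bilinZr !(bilinC (_ + _)) // !bilinDr !bilinZr.
by rewrite (bilinC w v) //; ring.
Qed.

Lemma bilin_congr (R : comNzRingType) n (A S : 'M[R]_n) v w :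
  bilin (S^T *m A *m S) v w = bilin A (S *m v) (S *m w).
Proof. by rewrite /bilin trmx_mul !mulmxA. Qed.

Lemma bilin_delta (R : comNzRingType) n (A : 'M[R]_n) i j :
  bilin A (delta_mx i 0) (delta_mx j 0) = A i j.
Proof. by rewrite /bilin trmx_delta -rowE -colE !mxE. Qed.

Definition replace_col (R : comNzRingType) n (k : 'I_n) (u : 'cV[R]_n) : 'M_n :=
  \matrix_(i, j) if j == k then u i 0 else (i == j)%:R.

Lemma col_replace_col (R : comNzRingType) n (k : 'I_n) (u : 'cV[R]_n) j :
  replace_col k u *m delta_mx j 0 = if j == k then u else delta_mx j 0.
Proof.
rewrite -colE; apply/matrixP => i l; rewrite ord1 !mxE.
by case: eqP => // _; rewrite mxE andbT.
Qed.

(** The cofactors along column [k] do not see the replaced column, so they are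
    those of the identity matrix. *)
Lemma det_replace_col (R : comNzRingType) n (k : 'I_n) (u : 'cV[R]_n) :
  \det (replace_col k u) = u k 0.
Proof.
rewrite (expand_det_col _ k).
have cofE i : cofactor (replace_col k u) i k = (i == k)%:R.
  have -> : cofactor (replace_col k u) i k = (\adj (1%:M : 'M[R]_n)) k i.
    rewrite mxE /cofactor; congr (_ * \det _); apply/matrixP => a b.
    by rewrite !mxE eq_sym (negbTE (neq_lift _ _)).
  by rewrite -[\adj _]mul1mx mul_mx_adj det1 mxE eq_sym.
rewrite (bigD1 k) //= cofE eqxx mulr1 mxE eqxx big1 ?addr0 // => i ik.
by rewrite cofE (negbTE ik) mulr0.
Qed.

Lemma congr_replace_col (R : comNzRingType) n (A : 'M[R]_n) k u i j :
  ((replace_col k u)^T *m A *m replace_col k u) i j =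
  bilin A (if i == k then u else delta_mx i 0)
          (if j == k then u else delta_mx j 0).
Proof. by rewrite -bilin_delta bilin_congr !col_replace_col. Qed.

(** * Dividing a form by a prime along an isotropic vector *)

(** The vector [u] spans an isotropic line in the kernel of [Q] modulo [p], for
    the quadratic form [u^T Q u / p] that [Q] induces on this kernel. *)
Definition isotropic_mod (F : fieldType) n (p : {poly F}) (Q : 'M[{poly F}]_n)
    (u : 'cV_n) : Prop :=
  (forall i, p %| (Q *m u) i 0) /\ p ^+ 2 %| bilin Q u u.

Lemma dvdp_bilin (F : fieldType) n (p : {poly F}) (Q : 'M[{poly F}]_n) u v :
  (forall i, p %| (Q *m u) i 0) -> p %| bilin Q v u.
Proof.
move=> pQu; rewrite bilin_colE.
by apply: (big_ind (fun f => p %| f)) => [|x y|i _];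
  [exact: dvdp0 | exact: dvdp_add | exact: dvdp_mull].
Qed.

(** Isotropy only depends on the line spanned by [u] modulo [p]: this is what
    allows one entry of [u] to be normalized to 1. *)
Lemma isotropic_mod_shift (F : fieldType) n (p s : {poly F})
    (Q : 'M[{poly F}]_n) (u w : 'cV_n) :
  Q^T = Q -> isotropic_mod p Q u -> isotropic_mod p Q (s *: u + p *: w).
Proof.
move=> sQ [pQu ppuu]; split=> [i|].
  rewrite mulmxDr -!scalemxAr mxE.
  by apply: dvdp_add; rewrite mxE; [apply/dvdp_mull/pQu | exact: dvdp_mulr].
have /dvdpP[c uwE] : p %| bilin Q u w by rewrite bilinC //; exact: dvdp_bilin.
rewrite bilin_combination // uwE (_ : s * p * _ = s * c * p ^+ 2); last by ring.
by do ?apply: dvdp_add; [exact: dvdp_mull .. | exact: dvdp_mulr].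
Qed.

(** With [U] the identity matrix whose [k]-th column is [u] and [D] the diagonal
    matrix with [p] in position [k], the hypotheses make [U^T Q U] divisible by
    [D] on both sides. *)
Lemma isotropic_descent (F : fieldType) n (p : {poly F}) (Q : 'M[{poly F}]_n)
    k u :
    p != 0 -> Q^T = Q -> isotropic_mod p Q u -> u k 0 = 1 ->
  exists S Q' : 'M[{poly F}]_n,
    [/\ Q'^T = Q', Q = S^T *m Q' *m S & \det S = p].
Proof.
move=> p0 sQ [pQu ppuu] uk1.
set U := replace_col k u; set N := U^T *m Q *m U.
have Uu : U \in unitmx by rewrite unitmxE det_replace_col uk1 unitr1.
have sN : N^T = N by rewrite /N !trmx_mul trmxK sQ mulmxA.
pose d (j : 'I_n) : {poly F} := if j == k then p else 1.
have d0 j : d j != 0 by rewrite /d; case: ifP; rewrite ?oner_neq0.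
have dN i j : d i * d j %| N i j.
  rewrite congr_replace_col /d; case: ifP => ik; case: ifP => jk.
  - by rewrite -expr2.
  - by rewrite mulr1 bilinC // dvdp_bilin.
  - by rewrite mul1r dvdp_bilin.
  - by rewrite mulr1 dvd1p.
have NU : N = U^T *m Q *m U by [].
clearbody N; pose D := diag_mx (\row_j d j).
pose Q' := \matrix_(i, j) (N i j %/ (d i * d j)).
have NE : N = D *m Q' *m D.
  apply/matrixP => i j; rewrite /D mul_diag_mx mul_mx_diag !mxE.
  by rewrite mulrAC mulrC divpK.
exists (D *m invmx U), Q'; split.
- by apply/matrixP => i j; rewrite !mxE mulrC -[in N j i]sN mxE.
- rewrite trmx_mul tr_diag_mx !mulmxA -(mulmxA _ D Q') -(mulmxA _ _ D) -NE.
  by rewrite NU !mulmxA -trmx_mul mulmxV // trmx1 mul1mx mulmxK.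
- rewrite det_mulmx det_inv det_replace_col uk1 invr1 mulr1 det_diag.
  rewrite (bigD1 k) //= mxE /d eqxx big1 ?mulr1 // => j jk.
  by rewrite mxE (negbTE jk).
Qed.

(** [phi] identifies [K] with the residue field of [F[X]] at the prime [p]. *)
Definition residue_map (F K : fieldType) (phi : {rmorphism {poly F} -> K})
    (p : {poly F}) : Prop :=
  (forall f, (phi f == 0) = (p %| f)) /\ (forall c, exists f, phi f = c).

Lemma residue_map_lift (F K : fieldType) (phi : {rmorphism {poly F} -> K}) p n
    (v : 'cV[K]_n) :
  residue_map phi p -> exists u : 'cV[{poly F}]_n, map_mx phi u = v.
Proof.
case=> _ surj.
have /fin_all_exists[f fE] (i : 'I_n) : exists f, phi f = v i 0 by exact: surj.
by exists (\col_i f i); apply/matrixP => i j; rewrite !mxE ord1 fE.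
Qed.

Lemma residue_map_dvd_col (F K : fieldType) (phi : {rmorphism {poly F} -> K}) p n
    (Q : 'M[{poly F}]_n) (u : 'cV_n) :
    residue_map phi p -> map_mx phi Q *m map_mx phi u = 0 ->
  forall i, p %| (Q *m u) i 0.
Proof.
case=> ker _ Qu i; rewrite -ker; apply/eqP.
by rewrite -map_mxM in Qu; move/matrixP/(_ i 0): Qu; rewrite !mxE.
Qed.

(** A unit entry of [u] modulo [p] is turned into an entry equal to 1 by the
    shift [s u - p r e_k], where [s u_k = 1 + r p]. *)
Lemma residue_descent (F K : fieldType) (phi : {rmorphism {poly F} -> K}) n
    (p : {poly F}) (Q : 'M[{poly F}]_n) (u : 'cV_n) :
    residue_map phi p -> p != 0 -> Q^T = Q ->
    isotropic_mod p Q u -> map_mx phi u != 0 ->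
  exists S Q' : 'M[{poly F}]_n,
    [/\ Q'^T = Q', Q = S^T *m Q' *m S & \det S = p].
Proof.
move=> [ker surj] p0 sQ iu /cV0Pn[k]; rewrite mxE => uk0.
have [s sE] := surj (phi (u k 0))^-1.
have /dvdpP[r rE] : p %| s * u k 0 - 1.
  by rewrite -ker rmorphB rmorphM rmorph1 sE mulVf // subrr.
apply: (isotropic_descent (k := k)
  (u := s *: u + p *: (- r *: delta_mx k 0))) => //.
  exact: isotropic_mod_shift.
by rewrite !mxE !eqxx mulr1 mulrN [p * r]mulrC -rE; ring.
Qed.

Lemma det0_col (F : idomainType) n (A : 'M[F]_n) :
  \det A = 0 -> exists2 v : 'cV[F]_n, v != 0 & A *m v = 0.
Proof.
rewrite -det_tr => /eqP/det0P[v v0 vA]; exists v^T.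
  by rewrite -trmx0 (inj_eq trmx_inj).
by apply: trmx_inj; rewrite trmx_mul trmxK vA trmx0.
Qed.

(** If the induced quadratic form does not vanish on the kernel vector [u], then
    the kernel of [Q] modulo [p] is not the line spanned by [u].  Replace row [k]
    of [Q] by [u^T Q / p]; the determinant becomes [u_k det Q / p], which
    vanishes modulo [p] when [p^2] divides [det Q].  A kernel vector [y] of the
    new matrix is in the kernel of [Q], because [u^T Q = 0] modulo [p] recovers
    the missing row, and it is orthogonal to [u^T Q / p] while [u] is not. *)
Lemma second_kernel_vector (F K : fieldType)
    (phi : {rmorphism {poly F} -> K}) n (p d c : {poly F})
    (Q : 'M[{poly F}]_n) (u : 'cV_n) :
    residue_map phi p -> p != 0 -> Q^T = Q ->
    \det Q = d * p -> phi d = 0 ->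
    (forall i, p %| (Q *m u) i 0) -> map_mx phi u != 0 ->
    bilin Q u u = c * p -> phi c != 0 ->
  exists y : 'cV[K]_n, map_mx phi Q *m y = 0 /\
    forall t, y + t *: map_mx phi u != 0.
Proof.
move=> [ker surj] p0 sQ detQ d0 pQu /cV0Pn[k]; rewrite mxE => uk0 uuE c0.
pose r j : {poly F} := (Q *m u) j 0 %/ p.
have rE j : (Q *m u) j 0 = r j * p by rewrite divpK.
pose B := \matrix_(i, j) if i == k then r j else Q i j.
have detB : phi (\det B) = 0.
  have : p * \det B = p * (u k 0 * d).
    transitivity (\det ((replace_col k u)^T *m Q)); last first.
      by rewrite det_mulmx det_tr det_replace_col detQ; ring.
    rewrite (_ : _ *m Q = diag_mx (\row_j if j == k then p else 1) *m B).
      rewrite det_mulmx det_diag (bigD1 k) //= mxE eqxx big1 ?mulr1 // => j jk.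
      by rewrite mxE (negbTE jk).
    apply/matrixP => i j; rewrite mul_diag_mx [RHS]mxE.
    rewrite [B i j]mxE [X in X * _]mxE mxE.
    case: eqP => [->|/eqP ik].
      rewrite [RHS]mulrC -rE [RHS]mxE; apply: eq_bigr => l _.
      by rewrite !mxE eqxx -[in Q j l]sQ mxE mulrC.
    rewrite mul1r (bigD1 i) //= big1 => [|l li].
      by rewrite !mxE (negbTE ik) eqxx mul1r addr0.
    by rewrite !mxE (negbTE ik) (negbTE li) mul0r.
  by move/(mulfI p0) => ->; rewrite rmorphM d0 mulr0.
have [y y0 By] : exists2 y : 'cV[K]_n, y != 0 & map_mx phi B *m y = 0.
  by apply: det0_col; rewrite det_map_mx.
have ry : \sum_j phi (r j) * y j 0 = 0.
  have /matrixP/(_ k 0) := By; rewrite !mxE => {2}<-.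
  by apply: eq_bigr => j _; rewrite !mxE eqxx.
have ru : \sum_j phi (r j) * phi (u j 0) = phi c.
  have /(mulIf p0) -> : c * p = (\sum_j r j * u j 0) * p.
    rewrite -uuE bilin_colE mulr_suml; apply: eq_bigr => j _.
    by rewrite rE; ring.
  by rewrite rmorph_sum; apply: eq_bigr => j _; rewrite rmorphM.
exists y; split; last first.
  (* Pairing with r sends y + t u to t * phi c, so t would be zero. *)
  move=> t; apply/negP => /eqP E.
  have : \sum_j phi (r j) * (y + t *: map_mx phi u) j 0 = 0.
    by rewrite E big1 // => j _; rewrite mxE mulr0.
  under eq_bigr do rewrite !mxE mulrDr (mulrCA _ t).
  rewrite big_split /= ry add0r -mulr_sumr ru => /eqP.
  rewrite mulf_eq0 (negbTE c0) orbF => /eqP t0.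
  by move: E; rewrite t0 scale0r addr0 => E; rewrite E eqxx in y0.
have Qy i : i != k -> (map_mx phi Q *m y) i 0 = 0.
  move=> ik; have /matrixP/(_ i 0) := By; rewrite !mxE => {2}<-.
  by apply: eq_bigr => j _; rewrite !mxE (negbTE ik).
(* Symmetry of Q turns p | Q u into a relation between the rows of Q mod p. *)
have uQ : (map_mx phi u)^T *m map_mx phi Q = 0.
  apply: trmx_inj; rewrite trmx_mul trmxK map_trmx sQ -map_mxM trmx0.
  apply/matrixP => i j; rewrite ord1 [LHS]mxE [RHS]mxE.
  by apply/eqP; rewrite ker.
have /matrixP/(_ 0 0) := congr1 (mulmxr y) uQ.
rewrite /= mul0mx -mulmxA 2!mxE (bigD1 k) //= big1 => [|i ik]; last first.
  by rewrite Qy ?mulr0.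
rewrite !mxE addr0 => /eqP; rewrite mulf_eq0 (negbTE uk0) /= => /eqP Qyk.
apply/matrixP => i j; rewrite ord1 [RHS]mxE.
by have [->|/Qy//] := eqVneq i k; rewrite mxE.
Qed.

(** Either the first kernel vector is isotropic, or there is a second one and
    the equation of isotropy for [w + tau u] is quadratic in [tau], hence
    solvable in the algebraically closed residue field. *)
Lemma closed_isotropic (F : fieldType) (K : numClosedFieldType)
    (phi : {rmorphism {poly F} -> K}) n (p d : {poly F}) (Q : 'M[{poly F}]_n) :
    residue_map phi p -> p != 0 -> Q^T = Q -> \det Q = d * p -> phi d = 0 ->
  exists2 u, isotropic_mod p Q u & map_mx phi u != 0.
Proof.
move=> res p0 sQ detQ d0; have [ker surj] := res.
have [v v0 Qv] : exists2 v : 'cV[K]_n, v != 0 & map_mx phi Q *m v = 0.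
  apply: det0_col; rewrite det_map_mx; apply/eqP.
  by rewrite ker detQ dvdp_mull.
have [u uE] := residue_map_lift v res.
have pQu : forall i, p %| (Q *m u) i 0.
  by apply: residue_map_dvd_col => //; rewrite uE.
have /dvdpP[c cE] : p %| bilin Q u u by exact: dvdp_bilin.
have [phic|phic] := eqVneq (phi c) 0.
  exists u; last by rewrite uE.
  by split=> //; rewrite cE expr2 dvdp_mul // -ker phic.
have u0 : map_mx phi u != 0 by rewrite uE.
have [y [Qy ind]] := second_kernel_vector res p0 sQ detQ d0 pQu u0 cE phic.
have [w wE] := residue_map_lift y res.
have pQw : forall i, p %| (Q *m w) i 0.
  by apply: residue_map_dvd_col => //; rewrite wE.
have /dvdpP[a aE] : p %| bilin Q w w by exact: dvdp_bilin.
have /dvdpP[b bE] : p %| bilin Q w u by exact: dvdp_bilin.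
pose t := (- phi b + sqrtC (phi b ^+ 2 - phi a * phi c)) / phi c.
have [tau tauE] := surj t.
exists (1 *: w + tau *: u); last first.
  by rewrite scale1r map_mxD map_mxZ wE tauE; exact: ind.
split=> [i|].
  rewrite mulmxDr -!scalemxAr mxE.
  by apply: dvdp_add; rewrite mxE; apply/dvdp_mull; [exact: pQw | exact: pQu].
rewrite bilin_combination // aE bE cE.
have -> : 1 ^+ 2 * (a * p) + 1 * tau * (b * p) *+ 2 + tau ^+ 2 * (c * p)
        = (a + (tau * b) *+ 2 + tau ^+ 2 * c) * p by ring.
rewrite expr2 dvdp_mul // -ker !rmorphD !rmorphM tauE.
apply/eqP/(mulfI phic); rewrite mulr0.
have : (phi c * t + phi b) ^+ 2 = phi b ^+ 2 - phi a * phi c.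
  by rewrite /t mulrC divfK // addrAC addNr add0r sqrtCK.
move/eqP; rewrite -subr_eq0 => /eqP <-; ring.
Qed.

(** * Nonnegative polynomials *)

Definition nonnegp (R : realFieldType) (f : {poly R}) : Prop :=
  forall x, 0 <= f.[x].

(** The points [a + d / (k + 2)] are infinitely many. *)
Lemma nonroot_near (R : realFieldType) (p : {poly R}) a d :
  p != 0 -> 0 < d -> exists2 y, `|y - a| < d & p.[y] != 0.
Proof.
move=> p0 d0; pose s := [seq a + d / k.+2%:R | k <- iota 0 (size p)].
have injs : injective (fun k : nat => a + d / k.+2%:R).
  move=> k l /addrI /(mulfI (lt0r_neq0 d0)) /invr_inj /eqP.
  by rewrite eqr_nat => /eqP[].
have [/hasP[y /mapP[k _ ->] pk]|] := boolP (has (fun y => p.[y] != 0) s).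
  exists (a + d / k.+2%:R) => //.
  rewrite addrAC subrr add0r gtr0_norm ?divr_gt0 // gtr_pMr //.
  by rewrite invf_lt1 ?ltr1n.
rewrite -all_predC => /allP sP.
have := max_poly_roots p0 (rs := s).
rewrite size_map size_iota ltnn map_inj_uniq // iota_uniq => H.
suff : false by []; apply: H => //; apply/allP => y /sP /=.
by rewrite negbK.
Qed.

Lemma nonnegp_cancel (R : rcfType) (p f : {poly R}) :
  p != 0 -> nonnegp (p ^+ 2 * f) -> nonnegp f.
Proof.
move=> p0 nn a; rewrite leNgt; apply/negP => fa.
have [|d d0 dP] := @poly_cont R a f (- f.[a]); first by rewrite oppr_gt0.
have [y /dP yd py] := nonroot_near a p0 d0.
have fy : f.[y] < 0 by move: yd; rewrite ltr_norml => /andP[_]; lra.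
have := nn y; rewrite hornerM horner_exp leNgt pmulr_rlt0 ?fy //.
by rewrite exprn_even_gt0.
Qed.

Lemma nonnegp_root (R : rcfType) (f : {poly R}) a :
  nonnegp f -> root f a -> ('X - a%:P) ^+ 2 %| f.
Proof.
move=> nn /factor_theorem[g fE].
suff /factor_theorem[h gE] : root g a.
  by rewrite fE gE -mulrA -expr2 dvdp_mull.
apply/rootP/eqP/negP => /negP ga0.
have [d d0 dP] : exists2 d : R, 0 < d &
    forall y, `|y - a| < d -> `|g.[y] - g.[a]| < `|g.[a]|.
  by apply: poly_cont; rewrite normr_gt0.
pose y := a - Num.sg g.[a] * (d / 2).
have /dP : `|y - a| < d.
  rewrite /y addrAC subrr add0r normrN normrM normr_sg ga0.
  by rewrite mul1r gtr0_norm; lra.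
have := nn y; rewrite fE hornerM !hornerE /= {2}/y addrAC subrr add0r.
have [ga|ga|/esym/eqP] := ltgtP 0 g.[a]; last by rewrite (negbTE ga0).
  rewrite (gtr0_sg ga) (gtr0_norm ga) mul1r ltr_norml => ? /andP[? ?].
  have : 0 < g.[y] * (d / 2) by apply: mulr_gt0; lra.
  lra.
rewrite (ltr0_sg ga) (ltr0_norm ga) mulN1r opprK ltr_norml => H /andP[? ?].
have : 0 < - g.[y] * (d / 2) by apply: mulr_gt0; lra.
lra.
Qed.

Lemma nonnegp_coef (R : realFieldType) (f : {poly R}) N :
  nonnegp f -> (size f <= N.+1)%N -> 0 <= f`_N.
Proof.
move=> nn; rewrite leq_eqVlt ltnS => /orP[/eqP sf|/leq_sizeP-> //].
rewrite -[N]/N.+1.-1 -sf -lead_coefE leNgt; apply/negP => lf.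
have [|x /(_ x (lexx x))] := @poly_pinfty_gt_lc _ (- f).
  by rewrite lead_coefN oppr_gt0.
rewrite lead_coefN hornerN; have := nn x; lra.
Qed.

(** Substituting [- X] for [X] changes the sign of an odd leading
    coefficient. *)
Lemma nonnegp_odd (R : realFieldType) (f : {poly R}) N :
  nonnegp f -> odd N -> (size f <= N.+1)%N -> (size f <= N)%N.
Proof.
move=> nn oN; rewrite leq_eqVlt ltnS => /orP[/eqP sf|//].
pose g := f \Po (- 'X).
have sX : size (- 'X : {poly R}) = 2%N by rewrite size_polyN size_polyX.
have sg : size g = N.+1 by rewrite size_comp_poly2.
have lg : g`_N = - f`_N.
  rewrite -[N]/N.+1.-1 -{1}sg -sf -!lead_coefE lead_coef_comp ?sX //.
  by rewrite lead_coefN lead_coefX sf -signr_odd oN mulrN1.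
have nng : nonnegp g by move=> x; rewrite horner_comp hornerN hornerX.
have := nonnegp_coef nng (eq_leq sg); rewrite lg oppr_ge0 => f_le0.
have := nonnegp_coef nn (eq_leq sf) => f_ge0.
have /eqP : f`_N = 0 by apply/eqP; rewrite eq_le f_le0.
by rewrite -[N]/N.+1.-1 -sf -lead_coefE lead_coef_eq0 -size_poly_eq0 sf.
Qed.

(** * Positive semidefinite polynomial matrices *)

(** Testing on polynomial vectors rather than on real vectors at each point
    makes the notion stable under polynomial changes of basis by mere substitution. *)
Definition psdpolmx (R : realFieldType) n (Q : 'M[{poly R}]_n) : Prop :=
  Q^T = Q /\ forall v, nonnegp (bilin Q v v).

Lemma psdpolmx_congr (R : realFieldType) n (Q S : 'M[{poly R}]_n) :
  psdpolmx Q -> psdpolmx (S^T *m Q *m S).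
Proof.
move=> [sQ nn]; split=> [|v]; first by rewrite !trmx_mul trmxK sQ mulmxA.
by rewrite bilin_congr.
Qed.

(** Evaluate the form of [S^T Q S] at [adj S v]: since [S adj S] is the scalar
    [det S], this gives [(det S)^2 v^T Q v], and the square cancels. *)
Lemma psdpolmx_descent (R : rcfType) n (Q S : 'M[{poly R}]_n) :
    Q^T = Q -> \det S != 0 -> psdpolmx (S^T *m Q *m S) -> psdpolmx Q.
Proof.
move=> sQ S0 [_ nn]; split=> // v; apply: (nonnegp_cancel S0).
have := nn (\adj S *m v); rewrite bilin_congr mulmxA mul_mx_adj mul_scalar_mx.
by rewrite bilinZr bilinC // bilinZr mulrA -expr2.
Qed.

Lemma horner_bilin (R : comNzRingType) n (Q : 'M[{poly R}]_n) v w x :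
  (bilin Q v w).[x] =
  bilin (map_mx (horner_eval x) Q) (map_mx (horner_eval x) v)
        (map_mx (horner_eval x) w).
Proof. by rewrite /bilin map_trmx -!map_mxM [RHS]mxE. Qed.

Lemma psdpolmx_eval (R : realFieldType) n (Q : 'M[{poly R}]_n) x :
  psdpolmx Q -> psdmx (map_mx (horner_eval x) Q).
Proof.
move=> [sQ nn]; split=> [|v]; first by rewrite map_trmx sQ.
have := nn (map_mx polyC v) x; rewrite horner_bilin -map_mx_comp.
rewrite (_ : map_mx (_ \o _) v = v) //.
by apply/matrixP => i j; rewrite !mxE /= /horner_eval hornerC.
Qed.

Lemma psdpolmxP (R : realFieldType) n (Q : 'M[{poly R}]_n) :
  Q^T = Q -> (forall x, psdmx (map_mx (horner_eval x) Q)) -> psdpolmx Q.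
Proof.
move=> sQ psd; split=> // v x; rewrite horner_bilin.
by case: (psd x) => _; apply.
Qed.

(** With [w = A u], the form at [w + t u] is [w^T A w + 2 t w^T w], affine in
    [t], so it can only stay nonnegative if [w^T w = 0]. *)
Lemma psdmx_ker (R : realFieldType) n (A : 'M[R]_n) (u : 'cV_n) :
  psdmx A -> bilin A u u = 0 -> A *m u = 0.
Proof.
move=> [sA nn] uu; set w := A *m u; pose q := \sum_i w i 0 ^+ 2.
have q_ge0 : 0 <= q by apply: sumr_ge0 => i _; exact: sqr_ge0.
have [/eqP|q0] := eqVneq q 0.
  rewrite psumr_eq0 => [/allP H|i _]; last exact: sqr_ge0.
  apply/matrixP => i j; rewrite ord1 [RHS]mxE; apply/eqP.
  by rewrite -sqrf_eq0; apply: H; rewrite mem_index_enum.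
pose t := - (bilin A w w + 1) / (q *+ 2).
have : 0 <= bilin A (1 *: w + t *: u) (1 *: w + t *: u) by exact: nn.
rewrite bilin_combination // uu.
have -> : bilin A w u = q by rewrite bilin_colE.
have -> : (1 * t * q) *+ 2 = - (bilin A w w + 1).
  by rewrite /t; field; rewrite q0.
by rewrite expr1n mul1r mulr0 addr0 opprD addrA subrr add0r oppr_ge0 ler10.
Qed.

(** The Schur complement [C - b b^T] of the first diagonal entry [a = s^2] is
    semidefinite: its value at [v] is that of [A] at [(x, v)], where
    [s x = - b^T v] completes the square.  When [a = 0] the first column
    vanishes by [psdmx_ker], and the same formulas hold with [b = 0]. *)
Lemma cholesky (R : rcfType) n (A : 'M[R]_n) :
  psdmx A -> exists G : 'M[R]_n, A = G^T *m G.
Proof.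
elim: n A => [|n IH] A; first by exists 0; apply/matrixP; case.
rewrite -[n.+1]/(1 + n)%N in A * => psdA; have [sA nn] := psdA.
pose a := A 0 0; pose w := dlsubmx A; pose s := Num.sqrt a.
pose b := s^-1 *: w.
have AE : A = block_mx a%:M w^T w (drsubmx A).
  rewrite -[LHS]submxK; congr block_mx.
    by apply/matrixP => i j; rewrite !ord1 !mxE /a; congr (A _ _); apply: val_inj.
  by rewrite /w -[in RHS]sA trmx_dlsub trmxK.
have a_ge0 : 0 <= a.
  by rewrite /a -bilin_delta; exact: nn.
have aE : a = s ^+ 2 by rewrite sqr_sqrtr.
have wE : w = s *: b.
  have [s0|s0] := eqVneq s 0; last by rewrite scalerA mulfV // scale1r.
  have : A *m (delta_mx 0 0 : 'cV_(1 + n)) = 0.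
    by apply: psdmx_ker => //; rewrite bilin_delta -/a aE s0 expr0n.
  rewrite -colE => /matrixP A0; rewrite s0 scale0r; apply/matrixP => i j.
  rewrite ord1 [RHS]mxE; have := A0 (rshift 1 i) 0; rewrite !mxE => <-.
  by congr (A _ _); apply: val_inj.
have [H HE] : exists H : 'M[R]_n, drsubmx A - b *m b^T = H^T *m H.
  apply: IH; split=> [|v].
    by rewrite linearB /= trmx_mul trmxK trmx_drsub sA.
  pose y := (b^T *m v) 0 0; pose x := - y / s.
  have sx : s * x = - y.
    rewrite /x mulrC; have [s0|s0] := eqVneq s 0; last by rewrite divfK.
    by rewrite s0 mulr0 /y /b s0 invr0 scale0r trmx0 mul0mx mxE oppr0.
  have := nn (col_mx x%:M v).
  rewrite [in X in X -> _]AE tr_col_mx mul_row_block mul_row_col.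
  rewrite tr_scalar_mx -!scalar_mxM !mulmxDl -!mulmxA !mul_scalar_mx.
  have wv : (w^T *m v) 0 0 = s * y by rewrite wE linearZ -scalemxAl mxE.
  have vb : (v^T *m b) 0 0 = y.
    by rewrite -[b]trmxK -trmx_mul mxE.
  have vw : (v^T *m w) 0 0 = s * y by rewrite wE -scalemxAr mxE vb.
  have vbbv : (v^T *m (b *m b^T *m v)) 0 0 = y ^+ 2.
    by rewrite -(mulmxA b) (mulmxA v^T) mxE big_ord1 vb expr2.
  set c := v^T *m (drsubmx A *m v).
  rewrite mul_mx_scalar -scalemxAr mulmxBl mulmxBr -/c.
  move/le_trans; apply; move: vbbv wv vw.
  move: (v^T *m _) (w^T *m v) (v^T *m w) c => M1 M2 M3 M4 E1 E2 E3.
  rewrite !mxE E1 E2 E3 aE eqxx mulr1n.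
  have -> : x * s ^+ 2 * x = y ^+ 2 by rewrite -[RHS]sqrrN -sx; ring.
  have -> : x * (s * y) = - y ^+ 2 by rewrite mulrA [x * s]mulrC sx; ring.
  lra.
exists (block_mx s%:M b^T 0 H).
rewrite tr_block_mx mulmx_block !trmx0 !mul0mx !mulmx0 !addr0 trmxK tr_scalar_mx.
rewrite -scalar_mxM -expr2 -aE mul_scalar_mx mul_mx_scalar -wE.
rewrite -HE addrC subrK -[s *: b^T]linearZ -wE.
exact: AE.
Qed.

(** * Degrees and leading coefficients *)

Lemma coef_prod_top (R : comNzRingType) (I : Type) (r : seq I)
    (f : I -> {poly R}) (e : I -> nat) :
    (forall i, (size (f i) <= (e i).+1)%N) ->
  (size (\prod_(i <- r) f i)%R <= (\sum_(i <- r) e i).+1)%N /\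
  (\prod_(i <- r) f i)`_(\sum_(i <- r) e i) = \prod_(i <- r) (f i)`_(e i).
Proof.
move=> sf; elim: r => [|i r [IHs IHc]].
  by rewrite !big_nil size_poly1 coefC.
rewrite !big_cons; split.
  apply: leq_trans (size_polyMleq _ _) _.
  by have := leq_add (sf i) IHs; rewrite addSn addnS; lia.
rewrite coefM (bigD1 (inord (e i))) //= inordK ?ltnS ?leq_addr // addKn IHc.
rewrite [X in _ + X]big1 ?addr0 // => j.
have [jlt|jgt|jeq] := ltngtP j (e i).
- move=> _; rewrite [X in _ * X]nth_default ?mulr0 //.
  by apply: leq_trans IHs _; lia.
- by move=> _; rewrite nth_default ?mul0r // (leq_trans (sf i)).
- by case/eqP; apply: val_inj; rewrite /= inordK ?ltnS ?leq_addr.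
Qed.

(** In each term of the Leibniz formula the bounds [d i + d (s i)] add up to the
    same total. *)
Lemma coef_det_top (R : comNzRingType) n (Q : 'M[{poly R}]_n) (d : 'I_n -> nat) :
    (forall i j, (size (Q i j) <= (d i + d j).+1)%N) ->
  (\det Q)`_(\sum_i (d i).*2) = \det (\matrix_(i, j) (Q i j)`_(d i + d j)).
Proof.
move=> sQ; rewrite coef_sum; apply: eq_bigr => s _.
have -> : (-1) ^+ s = ((-1) ^+ s)%:P :> {poly R} by rewrite rmorphXn rmorphN1.
rewrite coefCM; congr (_ * _).
have -> : (\sum_i (d i).*2 = \sum_i (d i + d (s i)))%N.
  have sE : (\sum_i d i = \sum_i d (s i))%N.
    exact: (reindex_inj (@perm_inj _ s)).
  rewrite big_split /= -sE -big_split.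
  by apply: eq_bigr => i _; rewrite /= addnn.
have [_ ->] := coef_prod_top (index_enum 'I_n) (fun i => sQ i (s i)).
by apply: eq_bigr => i _; rewrite mxE.
Qed.

(** A polynomial analogue of the bound on off-diagonal entries: for
    [v = e X^(d_j) E_i + X^(d_i) E_j], with [E_i] and [E_j] basis vectors and [e]
    a scalar, the diagonal contributions to [v^T Q v]
    have degree at most [2 (d_i + d_j)], so a larger degree of [Q_ij] would give
    a leading coefficient whose sign changes with [e = 1, -1]. *)
Lemma psdpolmx_size (R : realFieldType) n (Q : 'M[{poly R}]_n) (d : 'I_n -> nat) :
    psdpolmx Q -> (forall i, (size (Q i i) <= (d i).*2.+1)%N) ->
  forall i j, (size (Q i j) <= (d i + d j).+1)%N.
Proof.
move=> psdQ sQ i j; have [symQ nn] := psdQ.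
rewrite leqNgt; apply/negP => big.
pose s := (size (Q i j)).-1; pose N := (d i + d j + s)%N.
have sE : size (Q i j) = s.+1 by rewrite /s; lia.
have Q0 : Q i j != 0 by rewrite -size_poly_gt0 sE.
pose q (e : R) := e ^+ 2 *: ('X^((d j).*2) * Q i i)
  + (e *: ('X^(d i + d j) * Q i j)) *+ 2 + 'X^((d i).*2) * Q j j.
have nnq e : nonnegp (q e).
  pose v : 'cV[{poly R}]_n :=
    (e *: 'X^(d j)) *: delta_mx i 0 + 'X^(d i) *: delta_mx j 0.
  rewrite (_ : q e = bilin Q v v) // /v.
  rewrite bilin_combination // !bilin_delta /q -!muln2 !exprM exprD.
  by rewrite -!mul_polyC; ring.
have szXn a k l : (size (Q k l) <= a)%N -> forall b, (b + a <= N)%N ->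
    ('X^b * Q k l)`_N = 0.
  move=> sa b ba; rewrite coefXnM; case: ifP => // _.
  rewrite nth_default // (leq_trans sa) //.
  by rewrite leq_subRL ?(leq_trans (leq_addr _ _) ba).
have qN e : (q e)`_N = (e * lead_coef (Q i j)) *+ 2.
  rewrite /q !(coefD, coefMn, coefZ) (szXn _ _ _ (sQ i)); last by rewrite /N; lia.
  rewrite (szXn _ _ _ (sQ j)); last by rewrite /N; lia.
  rewrite mulr0 add0r addr0 coefXnM ifF; last by rewrite /N; lia.
  by rewrite /N addKn lead_coefE.
have sq e : (size (q e) <= N.+1)%N.
  have szM b k l : (b + size (Q k l) <= N.+1)%N ->
      (size ('X^b * Q k l)%R <= N.+1)%N.
    move=> h; apply: leq_trans (size_polyMleq _ _) _.
    by rewrite size_polyXn addSn.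
  apply/leq_sizeP => k kN; rewrite /q !(coefD, coefMn, coefZ).
  rewrite !(nth_default 0 (n := k)) ?(mulr0, mul0rn, addr0) //;
    apply: leq_trans _ kN; apply: szM; rewrite ?sE /N; 
    have := sQ i; have := sQ j; lia.
have := nonnegp_coef (nnq 1) (sq 1); have := nonnegp_coef (nnq (-1)) (sq (-1)).
rewrite !qN mul1r mulN1r => h1 h2.
by move: Q0; rewrite -lead_coef_eq0 => /eqP; apply; lra.
Qed.

(** * The unimodular case *)

Lemma factor_congr_unit (F : comUnitRingType) n (Q U G : 'M[F]_n) :
  U \in unitmx -> U^T *m Q *m U = G^T *m G ->
  Q = (G *m invmx U)^T *m (G *m invmx U).
Proof.
move=> Uu E; rewrite trmx_mul mulmxA -(mulmxA _ G^T) -E.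
by rewrite !mulmxA -trmx_mul mulmxV // trmx1 mul1mx mulmxK.
Qed.

Lemma det_congr (F : comNzRingType) n (Q S : 'M[F]_n) :
  \det (S^T *m Q *m S) = \det S ^+ 2 * \det Q.
Proof. by rewrite !det_mulmx det_tr; ring. Qed.

Lemma psdpolmx_anisotropic (R : rcfType) n (Q : 'M[{poly R}]_n) (u : 'cV_n) k :
  psdpolmx Q -> (\det Q).[0] != 0 -> u k 0 = 1 -> bilin Q u u != 0.
Proof.
move=> psdQ det0 uk1; apply/negP => /eqP uu.
have ker : map_mx (horner_eval 0) Q *m map_mx (horner_eval 0) u = 0.
  by apply: psdmx_ker; [exact: psdpolmx_eval | rewrite -horner_bilin uu horner0].
case/negP: det0; rewrite -[_.[0]]/(horner_eval 0 _) -det_map_mx -det_tr.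
apply/det0P; exists (map_mx (horner_eval 0) u)^T.
  apply/eqP => /matrixP/(_ 0 k); rewrite !mxE uk1 /horner_eval hornerC => /eqP.
  by rewrite oner_eq0.
by rewrite -trmx_mul ker trmx0.
Qed.

(** Let [c] be in the kernel of the matrix [L] of leading coefficients, with [d_k]
    maximal among the indices of its nonzero entries.  The vector with entries
    [(c_i / c_k) X^(d_k - d_i)] makes [u^T Q u] of degree at most [2 d_k] with
    leading coefficient [c^T L c / c_k^2 = 0], and nonnegativity removes the odd
    degree as well.  When [d_k = 0] the form would vanish on [u], which
    [det Q(0) <> 0] forbids. *)
Lemma psdpolmx_reduce (R : rcfType) n (Q : 'M[{poly R}]_n) (d : 'I_n -> nat) :
    psdpolmx Q -> (\det Q).[0] != 0 ->
    (forall i j, (size (Q i j) <= (d i + d j).+1)%N) ->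
    \det (\matrix_(i, j) (Q i j)`_(d i + d j)) = 0 ->
  exists k (u : 'cV_n),
    [/\ u k 0 = 1, (0 < d k)%N & (size (bilin Q u u) <= (d k).*2.-1)%N].
Proof.
move=> psdQ Q0 sQ /det0_col[c /cV0Pn[i0 ci0] Lc].
have [k ck kmax] := @arg_maxnP _ i0 (fun i => c i 0 != 0) d ci0.
pose u : 'cV[{poly R}]_n := \col_i ((c i 0 / c k 0) *: 'X^(d k - d i)).
have uk1 : u k 0 = 1 by rewrite mxE divff // subnn scale1r.
have uQu : bilin Q u u =
  \sum_i \sum_j (c i 0 / c k 0 * (c j 0 / c k 0)) *:
                ('X^(d k - d i + (d k - d j)) * Q i j).
  rewrite bilin_colE; apply: eq_bigr => i _; rewrite [(Q *m u) i 0]mxE mulr_sumr.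
  apply: eq_bigr => j _; rewrite !mxE exprD -!mul_polyC polyCM; ring.
have coefT i j N : ((d k).*2 <= N)%N ->
    ((c i 0 / c k 0 * (c j 0 / c k 0)) *:
                ('X^(d k - d i + (d k - d j)) * Q i j))`_N =
    (c i 0 / c k 0 * (c j 0 / c k 0)) *
       (if N == (d k).*2 then (Q i j)`_(d i + d j) else 0).
  (* Indices with c_i = 0 may have d_i > d_k; truncated subtraction is harmless
     there because the coefficient vanishes. *)
  move=> kN; rewrite coefZ.
  have [->|ci] := eqVneq (c i 0) 0; first by rewrite !mul0r.
  have [->|cj] := eqVneq (c j 0) 0; first by rewrite !(mul0r, mulr0).
  congr (_ * _); have := kmax _ ci; have := kmax _ cj => /= dj di.
  rewrite coefXnM ifF; last by apply/negbTE; rewrite -leqNgt; lia.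
  case: eqP => [->|/eqP Nk]; first by congr (_`__); lia.
  by rewrite nth_default // (leq_trans (sQ i j)) //; lia.
have top0 : \sum_i \sum_j (c i 0 / c k 0 * (c j 0 / c k 0)) *
      (Q i j)`_(d i + d j) = 0.
  rewrite big1 // => i _.
  transitivity (c i 0 / c k 0 ^+ 2 *
    (\matrix_(i, j) (Q i j)`_(d i + d j) *m c) i 0); last first.
    by rewrite Lc mxE mulr0.
  rewrite [X in _ = _ * X]mxE mulr_sumr; apply: eq_bigr => j _; rewrite mxE.
  by field.
have su : (size (bilin Q u u) <= (d k).*2)%N.
  apply/leq_sizeP => N kN; rewrite uQu coef_sum.
  under eq_bigr do (rewrite coef_sum; under eq_bigr do rewrite coefT //).
  case: eqP => [_|_]; first exact: top0.
  by rewrite big1 // => i _; rewrite big1 // => j _; rewrite mulr0.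
have uu0 : bilin Q u u != 0 by exact: psdpolmx_anisotropic uk1.
have dk0 : (0 < d k)%N.
  by move: su uu0; case: (d k) => //; rewrite double0 leqn0 size_poly_eq0 => ->.
exists k, u; split=> //; case: psdQ => _ /(_ u) nn.
apply: (nonnegp_odd nn); last by rewrite prednK ?double_gt0.
by case: (d k) dk0 => // e _; rewrite doubleS /= odd_double.
Qed.

(** The reduction changes one diagonal entry only, and lowers its size, so the
    total size of the diagonal decreases. *)
Lemma unimodular_factor (R : rcfType) n (Q : 'M[{poly R}]_n) :
  psdpolmx Q -> size (\det Q) = 1%N -> exists G : 'M[{poly R}]_n, Q = G^T *m G.
Proof.
have [N] := ubnP (\sum_i size (Q i i)).
elim: N Q => // N IH Q; rewrite ltnS => leN psdQ sdet.
have /size_poly1P[c c0 detc] : size (\det Q) == 1%N by rewrite sdet.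
(* Halving the size, not the degree, gives a bound without assuming that the
   degree is even or that the entry is nonzero. *)
pose d i := (size (Q i i))./2.
have sQ : forall i j, (size (Q i j) <= (d i + d j).+1)%N.
  apply: psdpolmx_size => // i.
  by rewrite -[X in (X <= _)%N]odd_double_half -add1n leq_add2r leq_b1.
have [d0|] := eqVneq (\sum_i (d i).*2)%N 0%N.
  have [|G GE] := @cholesky R n (map_mx (horner_eval 0) Q).
    exact: psdpolmx_eval.
  exists (map_mx polyC G); rewrite map_trmx -map_mxM -GE.
  apply/matrixP => i j; rewrite !mxE /horner_eval horner_coef0.
  apply: size1_polyC; apply: leq_trans (sQ i j) _.
  move/eqP: d0; rewrite sum_nat_eq0 => /forallP d0.
  by have := d0 i; have := d0 j; lia.
rewrite -lt0n => dpos; have := coef_det_top sQ; rewrite detc coefC ifF; last first.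
  by apply/negbTE; rewrite -lt0n.
move=> /esym/(psdpolmx_reduce psdQ _ sQ)[|k [u [uk1 dk su]]].
  by rewrite detc hornerC.
pose U := replace_col k u.
have detU : \det U = 1 by rewrite det_replace_col.
have [||| G GE] := IH (U^T *m Q *m U).
- apply: leq_trans leN; rewrite (bigD1 k) //= [X in (_ < X)%N](bigD1 k) //=.
  rewrite congr_replace_col eqxx -addSn leq_add //.
    apply: leq_ltn_trans su _.
    rewrite -[X in (_ < X)%N]odd_double_half prednK ?double_gt0 //.
    exact: leq_addl.
  rewrite leq_eqVlt; apply/orP; left; apply/eqP; apply: eq_bigr => i ik.
  by rewrite congr_replace_col (negbTE ik) bilin_delta.
- exact: psdpolmx_congr.
- by rewrite det_congr detU expr1n mul1r.
exists (G *m invmx U); apply: factor_congr_unit GE.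
by rewrite unitmxE detU unitr1.
Qed.

(** * Removing a root of the determinant *)

Definition eval_complex (R : rcfType) (z : R[i]) : {rmorphism {poly R} -> R[i]} :=
  horner_eval z \o map_poly (real_complex R).

Lemma residue_map_real (R : rcfType) (a : R) :
  residue_map (horner_eval a) ('X - a%:P).
Proof.
split=> [f|c]; first by rewrite dvdp_XsubCl.
by exists c%:P; exact: hornerC.
Qed.

Definition minpoly_complex (R : rcfType) (a b : R) : {poly R} :=
  ('X - a%:P) ^+ 2 + (b ^+ 2)%:P.

Lemma map_minpoly_complex (R : rcfType) (a b : R) :
  map_poly (real_complex R) (minpoly_complex a b) =
  ('X - (a +i* b)%C%:P) * ('X - (a -i* b)%C%:P).
Proof.
rewrite rmorphD rmorphXn rmorphB /= map_polyX !map_polyC /=.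
have -> : ((b ^+ 2)%:C)%C%:P = - ((0 +i* b)%C ^+ 2)%:P :> {poly R[i]}.
  by rewrite -polyCN; congr (_%:P); rewrite !expr2; simpc.
have -> : (a +i* b)%C = (a%:C)%C + (0 +i* b)%C by simpc.
have -> : (a -i* b)%C = (a%:C)%C - (0 +i* b)%C by simpc.
by rewrite polyCB polyCD polyC_exp; ring.
Qed.

Lemma size_minpoly_complex (R : rcfType) (a b : R) :
  size (minpoly_complex a b) = 3%N.
Proof.
rewrite -(size_map_poly (real_complex R)) map_minpoly_complex.
by rewrite size_mul ?polyXsubC_eq0 // !size_XsubC.
Qed.

(** The real polynomials of degree at most 1 already take each complex value at
    [a + i b] exactly once, because [1] and [a + i b] form a real basis. *)
Lemma residue_map_complex (R : rcfType) (a b : R) :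
  b != 0 -> residue_map (eval_complex (a +i* b)%C) (minpoly_complex a b).
Proof.
move=> b0; set phi := eval_complex _; set p := minpoly_complex a b.
have phip : phi p = 0.
  rewrite /phi /= /horner_eval map_minpoly_complex hornerM hornerXsubC subrr.
  by rewrite mul0r.
have phi1 (r0 r1 : R) : phi (r0%:P + r1 *: 'X) = ((r0 + r1 * a) +i* (r1 * b))%C.
  rewrite /phi /= /horner_eval rmorphD /= map_polyC linearZ /= map_polyX.
  by rewrite !hornerE; simpc.
split=> [f|[x y]]; last first.
  exists ((x - y / b * a)%:P + (y / b) *: 'X); rewrite phi1.
  by rewrite subrK divfK.
apply/idP/idP => [|/dvdpP[g ->]]; last by rewrite rmorphM phip mulr0.
rewrite {1}(divp_eq f p) rmorphD rmorphM phip mulr0 add0r /dvdp.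
have : (size (f %% p)%R <= 2)%N.
  rewrite -ltnS -(size_minpoly_complex a b) ltn_modp.
  by rewrite -size_poly_eq0 size_minpoly_complex.
move: (f %% p) => r sr.
have -> : r = (r`_0)%:P + r`_1 *: 'X.
  apply/polyP => i; rewrite coefD coefC coefZ coefX.
  case: i => [|[|i]] /=; rewrite ?(mulr0, mulr1, addr0, add0r) //.
  exact: (leq_sizeP _ _ sr).
rewrite phi1 eq_complex /= => /andP[/eqP h1 /eqP/eqP].
rewrite mulf_eq0 (negbTE b0) orbF => /eqP r1.
by move: h1; rewrite r1 mul0r addr0 => ->; rewrite scale0r addr0.
Qed.

(** Lift a real kernel vector of [Q(a)] to [u]: the nonnegative polynomial
    [u^T Q u] has a zero at [a], necessarily a double one. *)
Lemma psdpolmx_real_descent (R : rcfType) n (Q : 'M[{poly R}]_n) a :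
    psdpolmx Q -> root (\det Q) a ->
  exists S Q' : 'M[{poly R}]_n,
    [/\ Q'^T = Q', Q = S^T *m Q' *m S & (1 < size (\det S))%N].
Proof.
move=> [sQ nn] ra; have res := residue_map_real a.
have [v v0 Qv] : exists2 v : 'cV[R]_n,
    v != 0 & map_mx (horner_eval a) Q *m v = 0.
  by apply: det0_col; rewrite det_map_mx; apply/rootP.
have [u uE] := residue_map_lift v res.
have pQu : forall i, 'X - a%:P %| (Q *m u) i 0.
  by apply: (residue_map_dvd_col res); rewrite uE.
have iu : isotropic_mod ('X - a%:P) Q u.
  split=> //; apply: nonnegp_root; first exact: nn.
  by rewrite -dvdp_XsubCl; exact: dvdp_bilin.
have [|S [Q' [sQ' QE detS]]] :=
    residue_descent res (negbT (polyXsubC_eq0 a)) sQ iu; first by rewrite uE.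
by exists S, Q'; split=> //; rewrite detS size_XsubC.
Qed.

(** As [z] is a simple root of its minimal polynomial [p], even multiplicity
    forces the cofactor [det Q / p] to vanish at [z] too. *)
Lemma psdpolmx_complex_descent (R : rcfType) n (Q : 'M[{poly R}]_n) a b :
    Q^T = Q -> \det Q != 0 -> b != 0 ->
    let pC := map_poly (real_complex R) (\det Q) in
    root pC (a +i* b)%C -> ~~ odd (mup (a +i* b)%C pC) ->
  exists S Q' : 'M[{poly R}]_n,
    [/\ Q'^T = Q', Q = S^T *m Q' *m S & (1 < size (\det S))%N].
Proof.
move=> sQ Q0 b0 /= rz evz; set z := (a +i* b)%C in rz evz.
have res := residue_map_complex a b0; have [ker _] := res.
set p := minpoly_complex a b in res ker.
have p0 : p != 0 by rewrite -size_poly_eq0 size_minpoly_complex.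
have /dvdpP[d dE] : p %| \det Q by rewrite -ker.
have d0 : eval_complex z d = 0.
  apply/eqP; apply: contraNT evz => dz.
  have d0 : d != 0 by apply: contraNneq Q0 => d0; rewrite dE d0 mul0r.
  rewrite dE rmorphM mupMr //= map_minpoly_complex mupMl.
    by rewrite -['X - _]expr1 mup_XsubCX eqxx.
  rewrite root_XsubC eq_complex /= eqxx /=.
  by rewrite -addr_eq0 -mulr2n mulrn_eq0.
have [u iu u0] := closed_isotropic res p0 sQ dE d0.
have [S [Q' [sQ' QE detS]]] := residue_descent res p0 sQ iu u0.
by exists S, Q'; split=> //; rewrite detS size_minpoly_complex.
Qed.

Lemma mup_sqrM (F : fieldType) (x : F) (p q : {poly F}) :
  p != 0 -> q != 0 -> mup x (p ^+ 2 * q) = ((mup x p).*2 + mup x q)%N.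
Proof. by move=> p0 q0; rewrite expr2 !mupM ?mulf_neq0 // addnn. Qed.

(** Induction on the degree of [det Q]; parity of the multiplicities is inherited
    by [Q'] because [det Q = (det S)^2 det Q']. *)
Lemma even_psdpolmx_factor (R : realType) n (Q : 'M[{poly R}]_n) :
    psdpolmx Q -> \det Q != 0 -> all_complex_roots_even (\det Q) ->
  exists G : 'M[{poly R}]_n, Q = G^T *m G.
Proof.
have [N] := ubnP (size (\det Q)).
elim: N Q => // N IH Q; rewrite ltnS => leN psdQ Q0 evQ.
have [s1|s1] := eqVneq (size (\det Q)) 1%N; first exact: unimodular_factor.
have [S [Q' [sQ' QE sS]]] : exists S Q' : 'M[{poly R}]_n,
    [/\ Q'^T = Q', Q = S^T *m Q' *m S & (1 < size (\det S))%N].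
  have /closed_rootP[[a b] rz] : size (map_poly (real_complex R) (\det Q)) != 1%N.
    by rewrite size_map_poly.
  have [b0|b0] := eqVneq b 0; last first.
    by apply: psdpolmx_complex_descent (evQ _ rz) => //; case: psdQ.
  apply: (@psdpolmx_real_descent _ _ _ a) => //.
  by move: rz; rewrite b0 (fmorph_root (real_complex R)).
have detQ : \det Q = \det S ^+ 2 * \det Q' by rewrite QE det_congr.
have S0 : \det S != 0 by rewrite -size_poly_gt0 ltnW.
have Q'0 : \det Q' != 0 by apply: contraNneq Q0 => E; rewrite detQ E mulr0.
have [||||G GE] := IH Q' => //.
- apply: leq_trans leN; rewrite detQ expr2 -mulrA.
  rewrite !size_mul ?mulf_neq0 //; move: sS.
  have : (0 < size (\det Q'))%N by rewrite size_poly_gt0.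
  by move: (size (\det S)) (size (\det Q')) => s q; lia.
- by apply: psdpolmx_descent (S0) _ => //; rewrite -QE.
- move=> z rz; have := evQ z; rewrite detQ rmorphM rmorphXn rootM rz orbT.
  move=> /(_ isT); rewrite mup_sqrM ?map_poly_eq0 //.
  by rewrite oddD odd_double.
by exists (G *m S); rewrite QE GE trmx_mul !mulmxA.
Qed.

(** * Gram matrices and coefficient families *)

Lemma det_gram_even (R : realType) n (G : 'M[{poly R}]_n) :
  \det (G^T *m G) != 0 -> all_complex_roots_even (\det (G^T *m G)).
Proof.
rewrite det_mulmx det_tr mulf_eq0 orbb => G0 pC z _.
by rewrite /pC rmorphM mupM ?map_poly_eq0 // addnn odd_double.
Qed.

(** Since [Q_jj - G_ij^2] is a sum of squares, its leading coefficient cannot be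
    that of [- G_ij^2]. *)
Lemma gram_size (R : realFieldType) n (Q G : 'M[{poly R}]_n) m :
    Q = G^T *m G -> (forall i j, (size (Q i j) <= (2 * m).+1)%N) ->
  forall i j, (size (G i j) <= m.+1)%N.
Proof.
move=> QE sQ i j; rewrite leqNgt; apply/negP => big.
have G0 : G i j != 0 by rewrite -size_poly_gt0 (leq_ltn_trans _ big).
pose f := Q j j - G i j ^+ 2.
have nnf : nonnegp f.
  move=> x; rewrite /f QE mxE (bigD1 i) //= mxE addrAC -expr2 subrr add0r.
  rewrite horner_sum sumr_ge0 // => k _.
  by rewrite mxE -expr2 horner_exp sqr_ge0.
pose N := ((size (G i j)).-1.*2)%N.
have sG : size (G i j ^+ 2) = N.+1.
  by rewrite expr2 size_mul // /N; case: (size (G i j)) big => // s _; lia.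
have mN : (2 * m < N)%N by rewrite /N; case: (size (G i j)) big => // s; lia.
have sf : (size f <= N.+1)%N.
  apply: leq_trans (size_polyD _ _) _; rewrite size_polyN sG geq_max leqnn andbT.
  by apply: leq_trans (sQ j j) _; exact: ltnW.
have := nonnegp_coef nnf sf; rewrite coefB nth_default; last first.
  by apply: leq_trans (sQ j j) _.
rewrite sub0r oppr_ge0 -[N]/N.+1.-1 -sG -lead_coefE lead_coef_exp leNgt.
by rewrite exprn_even_gt0 //= lead_coef_eq0 G0.
Qed.

Lemma mxpol_entry (R : comNzRingType) n d (P : 'I_d.+1 -> 'M[R]_n) i k :
  mxpol P i k = \poly_(j < d.+1) P (inord j) i k.
Proof.
rewrite poly_def /mxpol summxE; apply: eq_bigr => j _.
by rewrite !mxE inord_val mulrC mul_polyC.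
Qed.

Lemma mxpol_coefs (R : comNzRingType) n d (G : 'M[{poly R}]_n) :
    (forall i k, (size (G i k) <= d.+1)%N) ->
  mxpol (fun j : 'I_d.+1 => map_mx (coefp j) G) = G.
Proof.
move=> sG; apply/matrixP => i k; rewrite mxpol_entry; apply/polyP => j.
rewrite coef_poly; case: ltnP => [jd|dj]; first by rewrite mxE inordK.
by rewrite nth_default // (leq_trans (sG i k)).
Qed.

Lemma mxpol_trE (R : comNzRingType) n d (P : 'I_d.+1 -> 'M[R]_n) :
  mxpol (mxpol_tr P) = (mxpol P)^T.
Proof.
apply/matrixP => i k; rewrite [RHS]mxE !mxpol_entry.
by apply/polyP => j; rewrite !coef_poly mxE.
Qed.

Theorem corollary4p2 (R : realType) (m n : nat) (hn : (1 <= n)%N)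
    (Q : 'I_(2 * m).+1 -> 'M[R]_n)
    (Qreg : mxpol_regular Q)
    (Qsym : mxpol_symmetric Q)
    (Qpsd : mxpol_psd Q) :
  all_complex_roots_even (\det (mxpol Q)) <->
  exists G : 'I_m.+1 -> 'M[R]_n,
    mxpol Q = mxpol (mxpol_tr G) *m mxpol G.
Proof.
split=> [evQ|[G QE]]; last first.
  by rewrite /mxpol_regular QE mxpol_trE in Qreg *; exact: det_gram_even.
have sQ i k : (size (mxpol Q i k) <= (2 * m).+1)%N.
  by rewrite mxpol_entry size_poly.
have psdQ : psdpolmx (mxpol Q).
  apply: psdpolmxP => [|x]; last by rewrite mxpol_evalE; exact: Qpsd.
  apply/matrixP => i k; rewrite mxE !mxpol_entry; apply/polyP => j.
  by rewrite !coef_poly [in RHS]Qsym mxE.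
have [G QE] := even_psdpolmx_factor psdQ Qreg evQ.
exists (fun j => map_mx (coefp j) G).
by rewrite mxpol_trE mxpol_coefs //; exact: gram_size QE sQ.
Qed.
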